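(* Let $a,b$ be integers with $2 \le a \le 2b$ and $2 \le b \le 2a$. The $(a,b)$-benzel can be tiled by bones if and only if there is an integer $k \ge 2$ such that $a = k(3k-1)/2$ and $b = k(3k+1)/2$, or $a = k(3k+1)/2$ and $b = k(3k-1)/2$.
   Context: Identify the plane with $\mathbb{C}$ and let $\omega = e^{2\pi i/3}$. Let $L_{-1} = \{x + y\omega : x,y \in \mathbb{Z},\ x+y \equiv -1 \pmod 3\}$. Each $\alpha \in L_{-1}$ is the center of a unit hexagonal cell with corners $\alpha \pm 1, \alpha \pm \omega, \alpha \pm \omega^2$; these cells tile the plane. For integers $a,b$ with $2 \le a \le 2b$ and $2 \le b \le 2a$, the $(a,b)$-benzel is the union of all unit cells lying entirely within the hexagon with vertices $a\omega+b$, $-a\omega^2-b$, $a\omega^2+b\omega$, $-a-b\omega$, $a+b\omega^2$, $-a\omega-b\omega^2$. A bone (tribone) is the union of three cells with centers $\alpha, \alpha+d, \alpha+2d$, where $\alpha \in L_{-1}$ and $d \in \{\pm(1-\omega), \pm(\omega-\omega^2), \pm(\omega^2-1)\}$ (three consecutive cells with collinear centers, in any of the three orientations). A tiling by bones is a partition of the region into bones (interiors disjoint, union equal to the region). *)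

(* Defs.v *)
From mathcomp Require Import all_boot all_order all_algebra.
From mathcomp Require Import all_classical all_reals all_analysis.
From mathcomp Require Import complex.

Set Implicit Arguments.
Unset Strict Implicit.
Unset Printing Implicit Defensive.

Import Order.TTheory GRing.Theory Num.Theory numFieldNormedType.Exports.

Local Open Scope classical_set_scope.
Local Open Scope ring_scope.

Section Benzels.
Context {R : realType}.

(* exp(2 i pi / 3) *)
Definition omega : R[i] := (cos (2 * pi / 3) +i* sin (2 * pi / 3))%C.

Definition convex_hull (s : seq R[i]) : set R[i] :=
  [set z | exists t : 'I_(size s) -> R,
     [/\ forall i, 0 <= t i,
         \sum_i t i = 1
       & z = \sum_i (t i)%:C%C * s`_i]].

Definition Lm1 : set R[i] :=
  [set z | exists x y : int,
     (x + y = -1 %[mod 3])%Z /\ z = x%:~R + y%:~R * omega].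

Definition cell (alpha : R[i]) : set R[i] :=
  convex_hull [:: alpha + 1; alpha - 1; alpha + omega; alpha - omega;
                  alpha + omega ^+ 2; alpha - omega ^+ 2].

(* For 2 <= a <= 2b and 2 <= b <= 2a, the listed points are, in cyclic order,
   the vertices of a convex hexagon, degenerating to a triangle when a = 2b
   or b = 2a. *)
Definition benzel_hexagon (a b : int) : set R[i] :=
  let A : R[i] := a%:~R in
  let B : R[i] := b%:~R in
  convex_hull [:: A * omega + B;
                  - A * omega ^+ 2 - B;
                  A * omega ^+ 2 + B * omega;
                  - A - B * omega;
                  A + B * omega ^+ 2;
                  - A * omega - B * omega ^+ 2].

Definition benzel (a b : int) : set R[i] :=
  \bigcup_(alpha in [set alpha | Lm1 alpha /\
                                 cell alpha `<=` benzel_hexagon a b])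
    cell alpha.

Definition bone_directions : seq R[i] :=
  [:: 1 - omega; - (1 - omega);
      omega - omega ^+ 2; - (omega - omega ^+ 2);
      omega ^+ 2 - 1; - (omega ^+ 2 - 1)].

Definition bone (alpha d : R[i]) : set R[i] :=
  cell alpha `|` cell (alpha + d) `|` cell (alpha + 2 * d).

Definition is_bone (B : set R[i]) : Prop :=
  exists alpha d : R[i],
    [/\ Lm1 alpha, d \in bone_directions & B = bone alpha d].

(* R[i] viewed as (R[i])^o carries the usual topology of the plane, given by
   the modulus. *)
Definition plane_interior (A : set R[i]) : set R[i] :=
  interior (A : set (R[i] : numFieldType)^o).

Definition is_bone_tiling (T : set (set R[i])) (D : set R[i]) : Prop :=
  [/\ T `<=` is_bone,
      trivIset T plane_interior
    & \bigcup_(B in T) B = D].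

Definition bone_tileable (D : set R[i]) : Prop :=
  exists T : set (set R[i]), is_bone_tiling T D.

End Benzels.

(* Main.v *)
(* A cell centred at x + y omega is recorded by integers (p, q) with
   x = 2 p + q - 1 and y = p - q; putting r = 1 - p - q, the cells are the integer
   triples (p, q, r) of sum 1, the rotation by 2 pi / 3 permutes the coordinates
   cyclically, and along a bone one of the three coordinates is constant.

   Necessity is the Conway-Lagarias argument.  The vertices of the cells are the
   triples of sum 0 or 2; an edge from u to u + e_i + e_j gets the remaining label
   k.  In the group generated by three involutions s_1, s_2, s_3 subject to
   s_k (s_i s_j)^3 s_k = (s_j s_i)^3, the boundary of a bone reads a trivial word,
   so a tiling gives a map from the vertices to any set on which this group acts,
   compatible with every edge not inside a bone.  The action used here is on
   frames travelling in a plane lattice, together with the area swept; following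
   the boundary of the benzel, the total area has to vanish, which happens only
   for a + b = 3 (a - b)^2.

   For sufficiency, let phi p = p - m, where m is the least number with
   p <= m (m + 1) / 2 (but at most k).  The cells with q <= phi p and p > phi r
   form one of three parabolic patches permuted by the rotation, and each row of
   a patch inside the benzel is cut into bones. *)
Require Import Defs.
From mathcomp Require Import all_boot all_order all_algebra.
From mathcomp Require Import zify ring lra.
From mathcomp Require Import all_classical all_reals all_analysis.
From mathcomp Require Import complex.

Set Implicit Arguments.
Unset Strict Implicit.
Unset Printing Implicit Defensive.

Import Order.TTheory GRing.Theory Num.Theory numFieldNormedType.Exports.

Local Open Scope ring_scope.

(** * Sufficiency: a tiling by three patches *)

(* Along a bone of direction D1 (resp. D2, D3) the coordinate p (resp. q, r) is
   constant. *)
Inductive dir := D1 | D2 | D3.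
Definition vx (d : dir) : int := if d is D1 then 0 else 1.
Definition vy (d : dir) : int :=
  match d with D1 => 1 | D2 => 0 | D3 => -1 end.

(** The bounded quantities are the differences [p - r], [q - p] and [r - q]; the bounds of the
    hexagon are tightened by one to make room for the whole cell. *)
Definition in_benzel (a b p q : int) : bool :=
  [&& 1 - a <= 2 * p + q - 1 <= b - 1,
      1 - a <= q - p <= b - 1
    & 1 - a <= 1 - p - 2 * q <= b - 1].

(* tau p q = (d, t) means that (p, q) is the t-th cell of a bone of direction d. *)
Definition bone_pos (S : int -> int -> bool) (tau : int -> int -> dir * nat) :=
  forall p q, S p q ->
    ((tau p q).2 < 3)%N /\
    forall t : nat, (t < 3)%N ->
      let d := (tau p q).1 in
      let p' := p + (t%:Z - (tau p q).2%:Z) * vx d in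
      let q' := q + (t%:Z - (tau p q).2%:Z) * vy d in
      S p' q' /\ tau p' q' = (d, t).

(** * Triangular numbers and their capped inverse *)

Fixpoint tri (n : nat) : int := if n is m.+1 then tri m + n%:Z else 0.

Lemma tri_ge n : n%:Z <= tri n.
Proof. elim: n => //= n; lia. Qed.

Lemma tri_double n : 2 * tri n = n%:Z * (n%:Z + 1).
Proof. elim: n => //= n; lia. Qed.

Lemma tri_mono m n : (m <= n)%N -> tri m <= tri n.
Proof.
elim: n => [|n IH]; first by case: m.
by rewrite leq_eqVlt => /orP[/eqP-> //|/IH] /=; lia.
Qed.

(* The least m such that c <= tri m, but at most k; 0 for c <= 0. *)
Fixpoint capped_root (k : nat) (c : int) : int :=
  if k is m.+1 then (if c <= tri m then capped_root m c else k%:Z) else 0.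

Lemma capped_root_le0 k c : c <= 0 -> capped_root k c = 0.
Proof.
elim: k => //= k IH c0; rewrite ifT; first exact: IH.
by have := tri_ge k; lia.
Qed.

Lemma capped_root_gt0 k c : (0 < k)%N -> 0 < c -> exists2 m : nat,
  capped_root k c = m%:Z + 1 & [/\ (m < k)%N, tri m < c &
    (m.+1 < k)%N -> c <= tri m + m%:Z + 1].
Proof.
elim: k => //= k IH _ c0; case: (leP c (tri k)) => ck; last first.
  by exists k; [lia|split=> //; rewrite ltnn].
case: k IH ck => [|k] IH ck; first by move: ck => /=; lia.
have [m -> [mk mc h]] := IH isT c0.
exists m => //; split=> //; first lia.
move=> _; have [/h //|] := ltnP m.+1 k.+1.
move=> km; have -> : m = k by lia.
by move: ck => /=; lia.
Qed.

(** * The tiling of a pentagonal benzel *)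

Section PentagonalTiling.
Variables (k : nat) (a b : int).
Hypotheses (k2 : (1 < k)%N) (ha : a = 3 * tri k.-1 + k%:Z) (hb : b = a + k%:Z).

Let phi c := c - capped_root k c.
Let P x y := y <= phi x.

Definition patch p q := P p q && ~~ P (1 - p - q) p.
(** Bones of a row are counted back from [q = phi p], whose offset is 2. *)
Let offset p q := `|((q - p - 1 + capped_root k p) %% 3)%Z|%N.

Lemma phi_bounds c : phi c <= c /\ (0 < c -> 0 <= phi c < c).
Proof.
rewrite /phi; case: (lerP c 0) => [c0|c0]; first by rewrite capped_root_le0 //; lia.
have [m -> [mk mc _]] := capped_root_gt0 (ltnW k2) c0.
by have := tri_ge m; lia.
Qed.

Lemma patch_gt0 p q : patch p q -> 0 < p.
Proof.
move=> /andP[]; rewrite /P => h1 h2.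
have [??] := phi_bounds p; have [??] := phi_bounds (1 - p - q); lia.
Qed.

(* Cyclically, exactly one of three truth values that are not all equal is true
   while its predecessor is false. *)
Lemma patch_partition p q (r := 1 - p - q) :
  [\/ [/\ patch p q, ~~ patch q r & ~~ patch r p],
      [/\ ~~ patch p q, patch q r & ~~ patch r p]
    | [/\ ~~ patch p q, ~~ patch q r & patch r p]].
Proof.
have -> : patch q r = P q r && ~~ P p q.
  by rewrite /patch; congr (_ && ~~ P _ _); rewrite /r; lia.
have -> : patch r p = P r p && ~~ P q r.
  by rewrite /patch; congr (_ && ~~ P _ _); rewrite /r; lia.
rewrite /patch -/r.
(* All three would give [q <= p], [r <= q], [p <= r], hence equality, but the sum is 1. *)
have : ~~ [&& P p q, P q r & P r p].
  rewrite /P /r; have [??] := phi_bounds p; have [??] := phi_bounds q.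
  have [??] := phi_bounds (1 - p - q); lia.
(* Some coordinate is positive; if none held, positivity would pass cyclically to the others and the
   sum would be at least 3. *)
have : [|| P p q, P q r | P r p].
  rewrite /P /r; have [??] := phi_bounds p; have [??] := phi_bounds q.
  have [??] := phi_bounds (1 - p - q); lia.
case: (P p q) (P q r) (P r p) => [] [] [] //= _ _;
  by [apply: Or31|apply: Or32|apply: Or33].
Qed.

(** [phi] is nondecreasing, and both [p + m + 1] and [p + m + 2] have capped root [m + 2], so [phi]
    reaches [p] exactly at the second one. *)
Lemma phi_lt_capped p r (m : nat) :
  (m.+1 < k)%N -> tri m < p -> p <= tri m + m%:Z + 1 ->
  (phi r < p) = (r <= p + (m%:Z + 1)).
Proof.
move=> Mk mp pm; have t0 := tri_ge m; rewrite /phi.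
case: (lerP r 0) => [r0|r0]; first by rewrite capped_root_le0 //; lia.
have [n -> [nk nr h]] := capped_root_gt0 (ltnW k2) r0.
have [nm|mn] := ltnP n m.
  have := tri_mono nm; move: h => /= h; have : r <= tri n + n%:Z + 1 by lia.
  move=> /=; lia.
have [|nm] := leqP n m.+1.
  rewrite leq_eqVlt => /orP[/eqP nE|nm]; first by subst n; move: nr => /=; lia.
  have nE : n = m by lia.
  by subst n; lia.
case: n nm mn h nr nk => // n nm _ _ nr _.
have : tri m.+1 <= tri n by apply: tri_mono; lia.
by move: nr => /=; lia.
Qed.

(** Below the cap, row [p] is the interval from [-2 p - m] to [p - m - 1], of length [3 p]. At the
    cap the row is cut by the sides [q - p = 1 - a] and, for large [p], [p - r = b - 1]; cells there
    have offsets 0 and 2 since [a = k] and [b = -k] modulo 3. *)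
Lemma patch_row p q (t : nat) (q' := q + t%:Z - (offset p q)%:Z) :
  in_benzel a b p q -> patch p q -> (t < 3)%N ->
  [/\ (offset p q < 3)%N, in_benzel a b p q', patch p q' & offset p q' = t].
Proof.
move=> hB hP t3; have p0 := patch_gt0 hP.
move: hP hB; rewrite /q' /offset /patch /P /phi.
have [m -> [mk mp mk']] := capped_root_gt0 (ltnW k2) p0.
set s := (_ %% 3)%Z; have hs : 0 <= s < 3 by rewrite /s; lia.
have [v hv] : exists v, q - p - 1 + (m%:Z + 1) = 3 * v + s
  by exists ((q - p - 1 + (m%:Z + 1)) %/ 3)%Z; rewrite /s; lia.
have -> : (`|s|%N : int) = s by lia.
have -> : `|((q + t%:Z - s - p - 1 + (m%:Z + 1)) %% 3)%Z|%N = t by lia.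
clearbody s => /andP[h1 h2]; rewrite /in_benzel => hB.
have phi_r := phi_bounds (1 - p - (q + t%:Z - s)).
move: h1 h2; have [Mk|kM] := ltnP m.+1 k.
  rewrite -!/(phi _) -!ltNge !(phi_lt_capped _ _ mp (mk' Mk)) //.
  have mono : tri m.+1 <= tri k.-1 by apply: tri_mono; lia.
  have hm0 := mk' Mk; have ht0 := tri_ge m.
  move: mono => /= mono h1 h2; clear - hm0 ht0 mono h1 h2 hs hv hB ha hb t3 Mk mp p0.
  split; [lia| |lia|by []].
  apply/and3P; split; apply/andP; split; lia.
have hm : k = m.+1 by lia.
rewrite -!/(phi _) -!ltNge => h1 h2.
have hq : 1 - p - (q + t%:Z - s) < p + k%:Z by move: ha hb; rewrite hm /=; lia.
(* Either [r] has capped root [k] and [r - k < p], or [r <= tri m < p]. *)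
have -> : phi (1 - p - (q + t%:Z - s)) < p.
  case: (lerP (1 - p - (q + t%:Z - s)) 0) => [|r0]; first lia.
  rewrite /phi; have [m' -> [mk'' _ h]] := capped_root_gt0 (ltnW k2) r0.
  have [Mk|] := ltnP m'.+1 k; last by lia.
  have : tri m'.+1 <= tri m by apply: tri_mono; lia.
  by move: (h Mk) => /=; lia.
have ha' : a = 3 * tri m + m%:Z + 1 by move: ha; rewrite hm /=; lia.
split; [lia| |lia|by []].
by apply/and3P; split; apply/andP; split; lia.
Qed.

(** Along [D2] the coordinate [r] decreases, whence the reversed offset. *)
Definition pentagonal_pos p q : dir * nat :=
  let r := 1 - p - q in
  if patch p q then (D1, offset p q)
  else if patch q r then (D2, 2 - offset q r)%N
  else (D3, offset r p).

Lemma bone_pos_pentagonal : bone_pos (in_benzel a b) pentagonal_pos.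
Proof.
have rotE p q : in_benzel a b q (1 - p - q) = in_benzel a b p q.
  by rewrite /in_benzel; lia.
move=> p q hB; rewrite /pentagonal_pos; set r := 1 - p - q.
have hqr : in_benzel a b q r by rewrite rotE.
have hrp : in_benzel a b r p.
  by have := rotE q r; rewrite hqr; have -> : 1 - q - r = p by rewrite /r; lia.
have [] := patch_partition p q; rewrite -/r => -[h1 h2 h3].
- rewrite h1 /=; split=> [|t t3]; first by have [] := patch_row hB h1 (isT : (0 < 3)%N).
  have [_ hB' hP' hO] := patch_row hB h1 t3.
  have -> : p + (t%:Z - (offset p q)%:Z) * 0 = p by lia.
  have -> : q + (t%:Z - (offset p q)%:Z) * 1 = q + t%:Z - (offset p q)%:Z by lia.
  by split=> //; rewrite hP' hO.
- rewrite (negbTE h1) h2 /=; split=> [|t t3]; first by lia.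
  have t3' : (2 - t < 3)%N by lia.
  have [lt3 hB' hP' hO] := patch_row hqr h2 t3'.
  have -> : q + (t%:Z - (2 - offset q r)%N%:Z) * 0 = q by lia.
  set p' := p + _.
  have rE : 1 - p' - q = r + (2 - t)%N%:Z - (offset q r)%:Z.
    by rewrite /p'; have : r = 1 - p - q by []; lia.
  split; first by rewrite -rotE rE.
  have [] := patch_partition p' q; rewrite rE hP' => -[g1 g2 g3] //.
  by rewrite (negbTE g1) hO subKn // -ltnS.
- rewrite (negbTE h1) (negbTE h2) /=; split=> [|t t3].
    by have [] := patch_row hrp h3 (isT : (0 < 3)%N).
  have [lt3 hB' hP' hO] := patch_row hrp h3 t3.
  set p' := p + _; set q' := q + _.
  have rE : 1 - p' - q' = r by rewrite /p' /q' /r; lia.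
  have pE : p' = p + t%:Z - (offset r p)%:Z by rewrite /p'; lia.
  split.
    rewrite -rotE rE -rotE; have -> // : 1 - q' - r = p' by rewrite -rE; lia.
    by rewrite pE.
  have [] := patch_partition p' q'; rewrite rE pE hP' => -[g1 g2 g3] //.
  by rewrite (negbTE g1) (negbTE g2) hO.
Qed.
End PentagonalTiling.

(** The reflection exchanging [q] and [r] reverses the bones of direction [D1] and exchanges [D2]
    with [D3]. *)
Lemma bone_pos_swap a b tau : bone_pos (in_benzel a b) tau ->
  exists tau', bone_pos (in_benzel b a) tau'.
Proof.
move=> h.
pose sw (x : dir * nat) : dir * nat :=
  match x.1 with D1 => (D1, 2 - x.2)%N | D2 => (D3, x.2) | D3 => (D2, x.2) end.
have swB p q : in_benzel b a p q = in_benzel a b p (1 - p - q).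
  by rewrite /in_benzel; lia.
exists (fun p q => sw (tau p (1 - p - q))) => p q; rewrite swB => hB /=.
have [+ h2] := h _ _ hB; move: h2.
case: (tau p (1 - p - q)) => d s h2 /= s3.
split=> [|t t3]; first by rewrite /sw; case: (d) => /=; lia.
have t3' : ((if d is D1 then 2 - t else t) < 3)%N by case: (d); lia.
have [+ +] := h2 _ t3'; rewrite swB.
set p' := p + _; set q' := _ + _; set p'' := p + _; set q'' := q + _.
have -> : p' = p''.
  by rewrite /p' /p''; case: (d) s3 t3'; rewrite /sw /= => s3 t3'; lia.
have -> : q' = 1 - p'' - q''.
  by rewrite /q' /p'' /q''; case: (d) s3 t3'; rewrite /sw /= => s3 t3'; lia.
move=> -> ->; split=> //; rewrite /sw; case: (d) t3' => //= t3'.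
by congr (_, _); lia.
Qed.

(** * Necessity: developing a tiling *)

Section RowFunction.
Variables (X : Type) (h h' : int -> X -> X).
Hypothesis hK : forall q, cancel (h' q) (h q).

Fixpoint row_up (q0 : int) (x : X) n : X :=
  if n is m.+1 then h (q0 + m%:Z + 1) (row_up q0 x m) else x.
Fixpoint row_down (q0 : int) (x : X) n : X :=
  if n is m.+1 then h' (q0 - m%:Z) (row_down q0 x m) else x.
Definition row_fun q0 x (q : int) : X :=
  if q0 <= q then row_up q0 x (absz (q - q0)%R) else row_down q0 x (absz (q0 - q)%R).

Lemma row_base q0 x : row_fun q0 x q0 = x.
Proof. by rewrite /row_fun lexx subrr. Qed.

Lemma row_step q0 x q : row_fun q0 x q = h q (row_fun q0 x (q - 1)).
Proof.
rewrite /row_fun; case: (ltrP q0 q) => [lt|le].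
  rewrite ltW // ifT; last by lia.
  have -> : absz (q - q0)%R = (absz (q - 1 - q0)%R).+1 by lia.
  by rewrite /=; congr h; lia.
rewrite [q0 <= q - 1]lt_geF; last by lia.
have -> : absz (q0 - (q - 1))%R = (absz (q0 - q)%R).+1 by lia.
rewrite /=; have -> : q0 - (absz (q0 - q)%R)%:Z = q by lia.
rewrite hK; case: (lerP q0 q) => // le'.
by have -> : q = q0; [lia|rewrite subrr].
Qed.

Lemma row_ind (Q : X -> Prop) q0 x q :
  (forall q x, Q x -> Q (h q x)) -> (forall q x, Q x -> Q (h' q x)) ->
  Q x -> Q (row_fun q0 x q).
Proof.
move=> Qh Qh' Qx; rewrite /row_fun; case: ifP => _.
  by elim: (absz _) => //= n IH; apply: Qh.
by elim: (absz _) => //= n IH; apply: Qh'.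
Qed.
End RowFunction.

Definition dir_eqb (d e : dir) : bool :=
  match d, e with D1, D1 | D2, D2 | D3, D3 => true | _, _ => false end.

(** * Extending a group action over the vertices of a tiled region *)

Section Development.
Variables (X : Type) (s : dir -> X -> X).
Hypothesis sK : forall d, involutive (s d).
Hypothesis bone_rel : forall i j k x, ~~ dir_eqb i j -> ~~ dir_eqb j k -> ~~ dir_eqb i k ->
  s k (s j (s i (s j (s i (s j (s i (s k x))))))) =
  s i (s j (s i (s j (s i (s j x))))).

Fixpoint run (w : seq dir) (x : X) : X := if w is d :: w' then run w' (s d x) else x.

Lemma run_cat w1 w2 x : run (w1 ++ w2) x = run w2 (run w1 x).
Proof. by elim: w1 x => //=. Qed.

Lemma run_revK w : cancel (run w) (run (rev w)).
Proof.
elim: w => //= d w IH x; rewrite rev_cons -cats1 run_cat IH /=; exact: sK.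
Qed.

Lemma revK_run w : cancel (run (rev w)) (run w).
Proof. by move=> x; have := run_revK (rev w) x; rewrite revK. Qed.

Variables (S : int -> int -> bool) (tau : int -> int -> dir * nat).
Hypothesis htau : bone_pos S tau.

(* 0: the edge between the cell (p, q) and its successor in direction d is on
   the boundary of a bone; 1 (resp. 2): it is inside a bone of which (p, q)
   (resp. its successor) is an end cell. *)
Definition inner d p q : nat :=
  if S p q && dir_eqb (tau p q).1 d then
    match (tau p q).2 with 0 => 1 | 1 => 2 | _ => 0 end
  else 0.

Lemma inner_succ d p q : ~~ S (p + vx d) (q + vy d) -> inner d p q = 0.
Proof.
rewrite /inner => nS; case Spq: (S p q) => //=.
have [] := htau Spq; case: (tau p q) => e r /= r3 h.
case: ifP => // ed; have E : e = d by case: e d ed {nS h} => [] [].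
subst e.
case: r r3 h => [|[|//]] _ h; [have [//|+ _] := h 1|have [//|+ _] := h 2].
  by rewrite !(subr0, mul1r) (negbTE nS).
by rewrite (_ : 2%:Z - 1%:Z = 1) // !mul1r (negbTE nS).
Qed.

Lemma dir_eqbP d e : reflect (d = e) (dir_eqb d e).
Proof. by case: d e => [] []; constructor. Qed.

(** The codes are chosen so that, along a bone, the edge entering the cell of position [t] has code
    [t]. *)
Lemma inner_pred d p q : S p q ->
  inner d (p - vx d) (q - vy d) = if dir_eqb (tau p q).1 d then (tau p q).2 else 0.
Proof.
move=> Spq; rewrite /inner; case: ifPn => [/andP[S' /dir_eqbP ed]|].
  have := htau S'; rewrite ed; move: ed.
  case: (tau (p - _) (q - _)) => e r /= _ [r3 h].
  have E : p - vx d + (r.+1%:Z - r%:Z) * vx d = p by lia.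
  have E' : q - vy d + (r.+1%:Z - r%:Z) * vy d = q by lia.
  case: r r3 h E E' => [|[|[|//]]] _ h E E'.
  + have := h 1%N isT; rewrite E E' => -[_ ->] /=; by case: (d).
  + have := h 2%N isT; rewrite E E' => -[_ ->] /=; by case: (d).
  + have := htau Spq; case: ifP => // /dir_eqbP.
    case: (tau p q) => e' r /= -> [r3 h'].
    case: r r3 h' => [|r] // r3 h'; have [] := h' r (ltnW r3).
    rewrite (_ : p + _ = p - vx d); last by lia.
    rewrite (_ : q + _ = q - vy d); last by lia.
    have [] := h 2%N isT; rewrite subrr !mul0r !addr0 => _ -> _ [r2].
    by move: r3; rewrite -r2.
rewrite negb_and; have := htau Spq; case: ifP => // /dir_eqbP.
case: (tau p q) => e' r /= -> [r3 h'].
case: r r3 h' => [|r] // r3 h'; have [] := h' r (ltnW r3).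
rewrite (_ : p + _ = p - vx d); last by lia.
rewrite (_ : q + _ = q - vy d); last by lia.
by move=> -> -> /=; case: (d).
Qed.

(* An edge inside a bone is replaced by the path around the end cell it bounds. *)
Definition transport d p q : seq dir :=
  match d with
  | D1 => nth [::] [:: [:: D1]; [:: D2; D3; D1; D2; D3]; [:: D3; D2; D1; D3; D2]] (inner D1 p q)
  | D2 => nth [::] [:: [:: D2]; [:: D1; D3; D2; D1; D3]; [:: D3; D1; D2; D3; D1]] (inner D2 p q)
  | D3 => nth [::] [:: [:: D3]; [:: D1; D2; D3; D1; D2]; [:: D2; D1; D3; D2; D1]] (inner D3 p (q + 1))
  end.

(** The words follow the two halves of the boundary of a cell. For an end cell the detours cancel;
    for a middle cell this is the bone relation. *)
Lemma transport_flat p q x : S p q ->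
  run (transport D3 p (q - 1) ++ rev (transport D2 p q) ++ transport D1 p q) x =
  run (transport D1 p (q - 1) ++ rev (transport D2 (p - 1) q) ++ transport D3 (p - 1) q) x.
Proof.
move=> Spq; rewrite /transport subrK.
have := inner_pred D1 Spq; have := inner_pred D2 Spq; have := inner_pred D3 Spq.
rewrite /= !subr0 opprK => -> -> ->; rewrite /inner Spq.
have [] := htau Spq; case: (tau p q) => d r /= r3 _.
case: d; case: r r3 => [|[|[|]]] //= _; rewrite ?bone_rel // ?sK //.
(* The middle cells remain; moving the base point conjugates the word into the form of
   [bone_rel]. *)
- have [y ->] : exists y, x = s D2 (s D3 (s D1 y)).
    by exists (s D1 (s D3 (s D2 x))); rewrite !sK.
  by rewrite bone_rel // !sK.
- have [y ->] : exists y, x = s D1 (s D3 (s D1 (s D2 y))).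
    by exists (s D2 (s D1 (s D3 (s D1 x)))); rewrite !sK.
  by rewrite bone_rel // !sK.
- have [y ->] : exists y, x = s D1 (s D2 (s D1 (s D2 (s D3 y)))).
    by exists (s D3 (s D2 (s D1 (s D2 (s D1 x))))); rewrite !sK.
  by rewrite bone_rel // !sK.
Qed.

(** Two edges through a vertex of sum 2, from the vertex [(p, q - 1)] of sum 0 to [(p, q)]; [vstep]
    leads likewise from [(p, q)] to [(p - 1, q)]. *)
Definition hstep p q := run (transport D3 p (q - 1) ++ rev (transport D2 p q)).
Definition hstep' p q := run (transport D2 p q ++ rev (transport D3 p (q - 1))).
Definition vstep p q := run (transport D1 p q ++ rev (transport D3 (p - 1) q)).

Lemma hstepK p q : cancel (hstep' p q) (hstep p q).
Proof. by move=> x; rewrite /hstep /hstep' !run_cat revK_run run_revK. Qed.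

Lemma step_square p q x : S p q ->
  vstep p q (hstep p q x) = hstep (p - 1) q (vstep p (q - 1) x).
Proof.
move=> Spq; rewrite /vstep /hstep !run_cat.
have := transport_flat x Spq; rewrite !run_cat => ->.
by rewrite run_revK revK_run.
Qed.

Variable Q : X -> Prop.
Hypothesis Qs : forall d x, Q x -> Q (s d x).

Lemma run_ind w x : Q x -> Q (run w x).
Proof. by elim: w x => //= d w IH x Qx; apply/IH/Qs. Qed.

Variables (L : int -> int) (N : int) (x0 : X).
Hypothesis SN : forall p q, S p q -> p <= N.
Hypothesis SL : forall p q, S p q ->
  L p < q /\ forall q', L p < q' <= q -> S p q'.
Hypothesis Qx0 : Q x0.

(** Row [p] is entered by one [vstep] from row [p + 1], at the vertex just before the cells of that
    row, and extended both ways by [hstep]. *)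
Fixpoint rows n : int -> X :=
  let p := N - n%:Z in
  row_fun (hstep p) (hstep' p) (if n is 0 then L p else L (p + 1))
    (if n is m.+1 then vstep (p + 1) (L (p + 1)) (rows m (L (p + 1))) else x0).
Let f p q := rows (absz (N - p)%R) q.

Lemma f_hstep p q : p <= N -> f p q = hstep p q (f p (q - 1)).
Proof.
move=> pN; have [n ->] : exists n : nat, p = N - n%:Z.
  by exists (absz (N - p)%R); lia.
rewrite /f; have -> : absz (N - (N - n%:Z))%R = n by lia.
by case: n => [|n] /=; apply: row_step => ?; apply: hstepK.
Qed.

(** True by construction at [q = L p]; each cell of [S] met along the row carries it one square
    further. *)
Lemma f_vstep p q : p <= N -> L p <= q -> (forall q', L p < q' <= q -> S p q') ->
  f (p - 1) q = vstep p q (f p q).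
Proof.
move=> pN Lq; have {Lq}-> : q = L p + (absz (q - L p)%R)%:Z by lia.
elim: (absz _) => [|n IH] h.
  rewrite addr0 /f; have -> : absz (N - (p - 1))%R = (absz (N - p)%R).+1 by lia.
  have E : N - (absz (N - p)%R).+1%:Z + 1 = p by lia.
  by rewrite [LHS]/= E row_base.
have h1 : L p + n.+1%:Z - 1 = L p + n%:Z by lia.
rewrite f_hstep; last by lia.
rewrite (f_hstep _ pN) step_square; last by apply: h; lia.
by rewrite h1 IH // => q' hq; apply: h; lia.
Qed.

Lemma Q_f p q : Q (f p q).
Proof.
rewrite /f; move: (absz _) => n; elim: n q => [|n IH] q /=.
  by apply: row_ind => // q' x Qx; apply: run_ind.
by apply: row_ind => [q' x Qx|q' x Qx|]; apply: run_ind.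
Qed.

(** On boundary edges [transport] is a single letter. Label [D2] is how [f1] is defined, [D3] comes
    from [f_hstep], and only [D1] needs the squares. *)
Theorem development : exists f0 f1 : int -> int -> X, forall p q,
  [/\ S (p + 1) q (+) S p (q + 1) -> f1 (p + 1) (q + 1) = s D3 (f0 p q),
      S (p + 1) q (+) S p q -> f1 (p + 1) q = s D2 (f0 p q),
      S p (q + 1) (+) S p q -> f1 p (q + 1) = s D1 (f0 p q)
    & Q (f1 p q)].
Proof.
exists f, (fun p q => run (transport D2 (p - 1) q) (f (p - 1) q)) => p q.
have bdry d p' q' : S p' q' (+) S (p' + vx d) (q' + vy d) -> inner d p' q' = 0.
  case S': (S (p' + _) _) => h; last by apply: inner_succ; rewrite S'.
  by rewrite /inner; case: (S p' q') h.
split=> [h|h|h|]; last exact/run_ind/Q_f.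
- rewrite addrK f_hstep; last first.
    by move: h; case S1: (S (p + 1) q); [have := SN S1; lia|rewrite addFb => /SN].
  rewrite /hstep run_cat revK_run addrK /transport (bdry D3) //=.
  by rewrite addrK addbC.
- by rewrite addrK /transport (bdry D2) //= addr0 addbC.
(* Such an edge lies at an end of row [p], so the cells after [L p] up to [q] are all in [S]. *)
have [pN Lq hS] : [/\ p <= N, L p <= q & forall q', L p < q' <= q -> S p q'].
  move: h; case S1: (S p q).
    by have [??] := SL S1; split; [exact: SN S1|exact: ltW|].
  rewrite addbF => S2; have [L2 hS] := SL S2; split; [exact: SN S2|lia|].
  by move=> q' hq; apply: hS; lia.
rewrite f_hstep; last by lia.
rewrite addrK f_vstep // /hstep /vstep !run_cat revK_run addrK revK_run.
by rewrite /transport (bdry D1) //= addr0 addbC.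
Qed.
End Development.

(** * Necessity: the area along the boundary *)

(* A frame (u, v) in the plane lattice, its position t, and the area swept by t. *)
Record state := State { u1 : int; u2 : int; v1 : int; v2 : int;
  t1 : int; t2 : int; area : int }.

(** Each generator reflects the frame; only [D1] also moves [t], by [u + v], and the area grows by
    the determinant of [t] and this displacement. *)
Definition act (d : dir) (x : state) : state :=
  let: State u1 u2 v1 v2 t1 t2 r := x in
  match d with
  | D1 => State (- v1) (- v2) (- u1) (- u2) (t1 + u1 + v1) (t2 + u2 + v2)
            (r + t1 * (u2 + v2) - t2 * (u1 + v1))
  | D2 => State (u1 + v1) (u2 + v2) (- v1) (- v2) t1 t2 r
  | D3 => State (- u1) (- u2) (u1 + v1) (u2 + v2) t1 t2 r
  end.

Definition frame_det (x : state) := u1 x * v2 x - u2 x * v1 x.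

Lemma actK d : involutive (act d).
Proof. by case: d => -[? ? ? ? ? ? ?] /=; congr State; ring. Qed.

(** Two distinct generators turn the frame by a third, so the cube of their product only adds a
    multiple of [frame_det] to the area; conjugation by the third generator changes the sign of
    [frame_det]. *)
Lemma act_bone_rel i j k x : ~~ dir_eqb i j -> ~~ dir_eqb j k -> ~~ dir_eqb i k ->
  act k (act j (act i (act j (act i (act j (act i (act k x))))))) =
  act i (act j (act i (act j (act i (act j x))))).
Proof.
by case: i j k x => [] [] [] // [? ? ? ? ? ? ?] _ _ _ /=; congr State; ring.
Qed.

Lemma frame_det_act d x : frame_det x != 0 -> frame_det (act d x) != 0.
Proof.
case: x => ? ? ? ? ? ? ?; rewrite /frame_det.
by case: d => /=; apply: contra => /eqP h; apply/eqP; lia.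
Qed.

(** The displacement is measured in the moving frame, and [ka] in units of [frame_det]. *)
Definition translate (al be ka : int) (x : state) : state :=
  State (u1 x) (u2 x) (v1 x) (v2 x)
    (t1 x + al * u1 x + be * v1 x) (t2 x + al * u2 x + be * v2 x)
    (area x + al * (t1 x * u2 x - t2 x * u1 x)
       + be * (t1 x * v2 x - t2 x * v1 x) + ka * frame_det x).

Lemma iter_translate n al be ka x :
  iter n (translate al be ka) x = translate (n%:Z * al) (n%:Z * be) (n%:Z * ka) x.
Proof.
case: x => ? ? ? ? ? ? ?; elim: n => [|n /= ->]; rewrite /translate /frame_det /=;
  congr State; rewrite ?intS; ring.
Qed.

Definition turn (d : dir) : dir := match d with D1 => D2 | D2 => D3 | D3 => D1 end.

(* f0 p q and f1 p q are the values at the vertices (p, q, - p - q) and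
   (p, q, 2 - p - q); an edge is on the boundary when exactly one of the two cells
   it bounds is in S. *)
Definition boundary_development (X : Type) (S : int -> int -> bool)
    (s : dir -> X -> X) (f0 f1 : int -> int -> X) := forall p q,
  [/\ S (p + 1) q (+) S p (q + 1) -> f1 (p + 1) (q + 1) = s D3 (f0 p q),
      S (p + 1) q (+) S p q -> f1 (p + 1) q = s D2 (f0 p q)
    & S p (q + 1) (+) S p q -> f1 p (q + 1) = s D1 (f0 p q)].

(** This lets every third of the boundary be read as the first one, with permuted generators. *)
Lemma boundary_development_turn X S (s : dir -> X -> X) f0 f1 :
  (forall p q, S (1 - p - q) p = S p q) -> boundary_development S s f0 f1 ->
  boundary_development S (fun d => s (turn d))
    (fun p q => f0 (- p - q) p) (fun p q => f1 (2 - p - q) p).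
Proof.
move=> rotS h p q; have [h3 h2 h1] := h (- p - q) p.
rewrite -(rotS (p + 1) q) -(rotS p (q + 1)) -(rotS p q).
have -> : 1 - (p + 1) - q = - p - q by lia.
have -> : 1 - p - (q + 1) = - p - q by lia.
have -> : 2 - (p + 1) - (q + 1) = - p - q by lia.
have -> : 2 - (p + 1) - q = - p - q + 1 by lia.
have -> : 2 - p - (q + 1) = - p - q + 1 by lia.
have -> : 1 - p - q = - p - q + 1 by lia.
split; first exact: h1.
  by rewrite addbC; exact: h3.
by rewrite /= => ?; apply: h2; rewrite addbC.
Qed.

(* The boundary, followed clockwise from the top of the side p - r = b - 1, is
   made of three thirds exchanged by the rotation; a third consists of n periods
   of one side, m periods of the next one and some edges at the corners, which
   depend on a + b modulo 3. *)
Definition walkX (X : Type) (s : dir -> X -> X) x := s D3 (s D2 (s D1 (s D2 x))).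
Definition walkY (X : Type) (s : dir -> X -> X) x := s D1 (s D3 (s D1 (s D2 x))).

Definition third0 (n m : nat) (X : Type) (s : dir -> X -> X) x :=
  s D1 (s D3 (iter m.+1 (walkY s) (iter n (walkX s) x))).
Definition third1 (n m : nat) (X : Type) (s : dir -> X -> X) x :=
  s D1 (s D2 (iter m (walkY s) (s D1 (s D2 (iter n (walkX s) x))))).
Definition third2 (n m : nat) (X : Type) (s : dir -> X -> X) x :=
  iter m.+1 (walkY s) (s D1 (s D2 (s D1 (s D2 (iter n (walkX s) x))))).

Section Thirds.
Variables (X : Type) (s : dir -> X -> X) (f0 f1 : int -> int -> X) (a b : int).
Hypothesis sK : forall d, involutive (s d).
Hypothesis hf : boundary_development (in_benzel a b) s f0 f1.

Lemma walkD1 p q p' q' : p' = p -> q' = q + 1 ->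
  in_benzel a b p (q + 1) (+) in_benzel a b p q -> f1 p' q' = s D1 (f0 p q).
Proof. by move=> -> ->; case: (hf p q). Qed.

Lemma walkD2 p q p' q' : p' = p + 1 -> q' = q ->
  in_benzel a b (p + 1) q (+) in_benzel a b p q -> f0 p q = s D2 (f1 p' q').
Proof. by move=> -> ->; case: (hf p q) => _ h _ /h ->; rewrite sK. Qed.

Lemma walkD3 p q p' q' : p' = p + 1 -> q' = q + 1 ->
  in_benzel a b (p + 1) q (+) in_benzel a b p (q + 1) -> f1 p' q' = s D3 (f0 p q).
Proof. by move=> -> ->; case: (hf p q) => h _ _ /h ->. Qed.

Lemma walkD3' p q p' q' : p' = p + 1 -> q' = q + 1 ->
  in_benzel a b (p + 1) q (+) in_benzel a b p (q + 1) -> f0 p q = s D3 (f1 p' q').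
Proof. by move=> -> ->; case: (hf p q) => h _ _ /h ->; rewrite sK. Qed.

(** A period moves the vertex by [(-1, 2)], along the side; the bounds on [g1 - g2] keep the walk
    between the corners. *)
Lemma sideX g1 g2 (n : nat) : 2 * g1 + g2 - 2 = b ->
  g1 - g2 <= a -> b - a <= g1 - g2 - 1 - 3 * n%:Z -> a + 2 <= 2 * b -> b + 2 <= 2 * a ->
  f1 (g1 - n%:Z) (g2 + 2 * n%:Z) = iter n (walkX s) (f1 g1 g2).
Proof.
move=> hb ha hn ab ba; elim: n hn => [|n IH] hn; first by rewrite subr0 addr0.
rewrite iterS -IH; last by lia.
rewrite /walkX.
rewrite -(@walkD2 (g1 - n%:Z - 1) (g2 + 2 * n%:Z)); [|lia|lia|rewrite /in_benzel; lia].
rewrite -(@walkD1 _ _ (g1 - n%:Z - 1) (g2 + 2 * n%:Z + 1)); [|lia|lia|rewrite /in_benzel; lia].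
rewrite -(@walkD2 (g1 - n%:Z - 2) (g2 + 2 * n%:Z + 1)); [|lia|lia|rewrite /in_benzel; lia].
by apply: walkD3; [lia|lia|rewrite /in_benzel; lia].
Qed.

Lemma sideY g1 g2 (n : nat) : g1 + 2 * g2 = a + 1 ->
  2 * g1 + g2 - 2 <= b -> - b <= g1 - g2 - 3 * n%:Z ->
  a + 2 <= 2 * b -> b + 2 <= 2 * a ->
  f1 (g1 - 2 * n%:Z) (g2 + n%:Z) = iter n (walkY s) (f1 g1 g2).
Proof.
move=> ha hb hn ab ba; elim: n hn => [|n IH] hn; first by rewrite subr0 addr0.
rewrite iterS -IH; last by lia.
rewrite /walkY.
rewrite -(@walkD2 (g1 - 2 * n%:Z - 1) (g2 + n%:Z)); [|lia|lia|rewrite /in_benzel; lia].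
rewrite -(@walkD1 _ _ (g1 - 2 * n%:Z - 1) (g2 + n%:Z + 1)); [|lia|lia|rewrite /in_benzel; lia].
rewrite -(@walkD3' (g1 - 2 * n%:Z - 2) (g2 + n%:Z)); [|lia|lia|rewrite /in_benzel; lia].
by apply: walkD1; [lia|lia|rewrite /in_benzel; lia].
Qed.

Lemma walk_third0 (n m : nat) :
  a = 2 * n%:Z + 2 + m.+1%:Z -> b = n%:Z + 1 + 2 * m.+1%:Z ->
  f1 (2 - (n%:Z + m.+1%:Z + 1) - (1 - n%:Z)) (n%:Z + m.+1%:Z + 1) =
  third0 n m s (f1 (n%:Z + m.+1%:Z + 1) (1 - n%:Z)).
Proof.
move=> ha hb; have -> : 2 - (n%:Z + m.+1%:Z + 1) - (1 - n%:Z) = - m.+1%:Z by lia.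
rewrite /third0 -sideX; [|lia..].
rewrite -sideY; [|lia..].
rewrite -(@walkD3' (- m.+1%:Z) (n%:Z + m.+1%:Z)); [|lia|lia|rewrite /in_benzel; lia].
by apply: walkD1; [lia|lia|rewrite /in_benzel; lia].
Qed.

Lemma walk_third1 (n m : nat) :
  a = 2 * n%:Z + m%:Z + 2 -> b = n%:Z + 2 * m%:Z + 2 ->
  f1 (2 - (n%:Z + m%:Z + 2) - - n%:Z) (n%:Z + m%:Z + 2) =
  third1 n m s (f1 (n%:Z + m%:Z + 2) (- n%:Z)).
Proof.
move=> ha hb; have -> : 2 - (n%:Z + m%:Z + 2) - - n%:Z = - m%:Z by lia.
rewrite /third1 -sideX; [|lia..].
rewrite -(@walkD2 (m%:Z + 1) n%:Z); [|lia|lia|rewrite /in_benzel; lia].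
rewrite -(@walkD1 _ _ (m%:Z + 1) (n%:Z + 1)); [|lia|lia|rewrite /in_benzel; lia].
rewrite -sideY; [|lia..].
rewrite -(@walkD2 (- m%:Z) (n%:Z + m%:Z + 1)); [|lia|lia|rewrite /in_benzel; lia].
by apply: walkD1; [lia|lia|rewrite /in_benzel; lia].
Qed.

Lemma walk_third2 (n m : nat) :
  a = 2 * n%:Z + m.+1%:Z + 3 -> b = n%:Z + 2 * m.+1%:Z + 2 ->
  f1 (2 - (n%:Z + m.+1%:Z + 2) - - n%:Z) (n%:Z + m.+1%:Z + 2) =
  third2 n m s (f1 (n%:Z + m.+1%:Z + 2) (- n%:Z)).
Proof.
move=> ha hb; have -> : 2 - (n%:Z + m.+1%:Z + 2) - - n%:Z = - m.+1%:Z by lia.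
rewrite /third2 -sideX; [|lia..].
rewrite -(@walkD2 (m.+1%:Z + 1) n%:Z); [|lia|lia|rewrite /in_benzel; lia].
rewrite -(@walkD1 _ _ (m.+1%:Z + 1) (n%:Z + 1)); [|lia|lia|rewrite /in_benzel; lia].
rewrite -(@walkD2 m.+1%:Z (n%:Z + 1)); [|lia|lia|rewrite /in_benzel; lia].
rewrite -(@walkD1 _ _ m.+1%:Z (n%:Z + 2)); [|lia|lia|rewrite /in_benzel; lia].
rewrite -sideY; [|lia..].
by congr f1; lia.
Qed.
End Thirds.

(** The hypothesis on [W] covers all developments, in particular the two rotated ones; after three
    thirds the walk is back at its start. *)
Lemma full_turn (X : Type) (W : (dir -> X -> X) -> X -> X) (a b g1 g2 : int)
    (s : dir -> X -> X) f0 f1 :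
  (forall s f0 f1, (forall d, involutive (s d)) ->
     boundary_development (in_benzel a b) s f0 f1 ->
     f1 (2 - g1 - g2) g1 = W s (f1 g1 g2)) ->
  (forall d, involutive (s d)) -> boundary_development (in_benzel a b) s f0 f1 ->
  W (fun d => s (turn (turn d))) (W (fun d => s (turn d)) (W s (f1 g1 g2))) = f1 g1 g2.
Proof.
move=> hW sK h0.
have rotS p q : in_benzel a b (1 - p - q) p = in_benzel a b p q by rewrite /in_benzel; lia.
have h1 := boundary_development_turn rotS h0.
have h2 := boundary_development_turn rotS h1.
rewrite -(hW _ _ _ sK h0).
have /= <- := hW _ _ _ (fun d => sK (turn d)) h1.
have -> : 2 - (2 - g1 - g2) - g1 = g2 by lia.
have := hW _ _ _ (fun d => sK (turn (turn d))) h2.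
rewrite /=; have -> : 2 - (2 - (2 - g1 - g2) - g1) - (2 - g1 - g2) = g1 by lia.
by have -> : 2 - (2 - g1 - g2) - g1 = g2 by lia.
Qed.

Lemma ceil_half (z : int) : z <= 2 * (- ((- z) %/ 2)%Z) <= z + 1.
Proof. lia. Qed.

Lemma benzel_development a b tau : bone_pos (in_benzel a b) tau ->
  exists f0 f1, boundary_development (in_benzel a b) act f0 f1 /\
    forall p q, frame_det (f1 p q) != 0.
Proof.
move=> htau.
(* [c p] is a ceiling; [L p] is one less than the largest of the three lower bounds on [q] in row
   [p]. *)
pose c p := - ((- (2 - p - b)) %/ 2)%Z.
pose L p := Num.max (Num.max (2 - 2 * p - a) (p + 1 - a)) (c p) - 1.
have SN p q : in_benzel a b p q -> p <= `|a| + `|b| by rewrite /in_benzel; lia.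
have SL p q : in_benzel a b p q ->
    L p < q /\ forall q', L p < q' <= q -> in_benzel a b p q'.
  have hc : 2 - p - b <= 2 * c p <= 2 - p - b + 1 := ceil_half _.
  rewrite /L /in_benzel; move: (c p) hc => z hz h; split; first lia.
  move=> q' hq; apply/and3P; split; lia.
have [f0 [f1 h]] := development actK act_bone_rel htau frame_det_act SN SL
  (isT : frame_det (State 1 0 0 1 0 0 0) != 0).
by exists f0, f1; split=> p q; have [] := h p q.
Qed.


(** * Evaluation of the boundary word *)

Definition frame_turn (x : state) : state :=
  State (- (u1 x + v1 x)) (- (u2 x + v2 x)) (u1 x) (u2 x) (t1 x) (t2 x) (area x).

Lemma frame_turn3 x : frame_turn (frame_turn (frame_turn x)) = x.
Proof. by case: x => *; rewrite /frame_turn /=; congr State; ring. Qed.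

Lemma translate_turn al be ka x :
  translate al be ka (frame_turn x) = frame_turn (translate (be - al) (- al) ka x).
Proof.
by case: x => *; rewrite /translate /frame_turn /frame_det /=; congr State; ring.
Qed.

(** This is the law of a Heisenberg group, with area as the central coordinate. *)
Lemma translate_comp al be ka al' be' ka' x :
  translate al be ka (translate al' be' ka' x) =
  translate (al' + al) (be' + be) (ka' + ka + al' * be - be' * al) x.
Proof. by case: x => *; rewrite /translate /frame_det /=; congr State; ring. Qed.

Lemma translate_area_fix ka x : frame_det x != 0 -> translate 0 0 ka x = x -> ka = 0.
Proof.
move=> hx /(congr1 area)/= /eqP.
by rewrite !mul0r !addr0 -subr_eq0 addrC addKr mulf_eq0 (negbTE hx) orbF => /eqP.
Qed.

Ltac state_ring :=
  by case=> *; rewrite /walkX /walkY /translate /frame_turn /frame_det /=; congr State; ring.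

Lemma walkX_act : walkX act =1 translate 1 0 0.
Proof. state_ring. Qed.
Lemma walkY_act : walkY act =1 translate 0 (-1) (-1).
Proof. state_ring. Qed.
Lemma walkX_turn : walkX (fun d => act (turn d)) =1 translate (-1) (-1) 0.
Proof. state_ring. Qed.
Lemma walkY_turn : walkY (fun d => act (turn d)) =1 translate (-1) 0 0.
Proof. state_ring. Qed.
Lemma walkX_turn2 : walkX (fun d => act (turn (turn d))) =1 translate 0 1 1.
Proof. state_ring. Qed.
Lemma walkY_turn2 : walkY (fun d => act (turn (turn d))) =1 translate 1 1 0.
Proof. state_ring. Qed.
Lemma act31 x : act D1 (act D3 x) = frame_turn (translate 0 1 0 x).
Proof. move: x; state_ring. Qed.
Lemma act12 x : act D2 (act D1 x) = frame_turn (translate 1 1 0 x).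
Proof. move: x; state_ring. Qed.
Lemma act23 x : act D3 (act D2 x) = frame_turn (translate 0 0 0 x).
Proof. move: x; state_ring. Qed.
Lemma act21 x : act D1 (act D2 x) = frame_turn (frame_turn (translate 1 0 0 x)).
Proof. move: x; state_ring. Qed.
Lemma act32 x : act D2 (act D3 x) = frame_turn (frame_turn (translate 0 0 0 x)).
Proof. move: x; state_ring. Qed.
Lemma act13 x : act D3 (act D1 x) = frame_turn (frame_turn (translate 1 1 0 x)).
Proof. move: x; state_ring. Qed.

Definition turns (W : (dir -> state -> state) -> state -> state) x :=
  W (fun d => act (turn (turn d))) (W (fun d => act (turn d)) (W act x)).

(** The closed walk fixes a state of nonzero determinant, while [translate 0 0 ka] adds [ka] times
    that determinant to its area. *)
Lemma tiling_area (a b g1 g2 : int) (tau : int -> int -> dir * nat)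
    (W : (dir -> state -> state) -> state -> state) (ka : int) :
  bone_pos (in_benzel a b) tau ->
  (forall s f0 f1, (forall d, involutive (s d)) ->
     boundary_development (in_benzel a b) s f0 f1 ->
     f1 (2 - g1 - g2) g1 = W s (f1 g1 g2)) ->
  turns W =1 translate 0 0 ka -> ka = 0.
Proof.
move=> /benzel_development[f0 [f1 [h Q]]] hW tW.
have := full_turn hW actK h; rewrite -/(turns W _) tW => /translate_area_fix; exact.
Qed.

Arguments act : simpl never.
Arguments translate : simpl never.
Arguments frame_turn : simpl never.

(** Turns are pushed outwards, where they cancel in threes, and the translations are merged. *)
Ltac normalize_turns :=
  rewrite (eq_iter walkX_act) (eq_iter walkY_act) (eq_iter walkX_turn) (eq_iter walkY_turn)
    (eq_iter walkX_turn2) (eq_iter walkY_turn2) !iter_translate /=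
    ?(act31, act12, act23, act21, act32, act13)
    !(translate_comp, translate_turn, frame_turn3).

(** For the [a] and [b] of [walk_third0] this area is [(a - b)^2 - (a + b) / 3]. *)
Lemma turns_third0 n m :
  turns (@third0 n m state) =1
  translate 0 0 ((n%:Z + 1 - m.+1%:Z) ^+ 2 - (n%:Z + 1 + m.+1%:Z)).
Proof.
move=> x; rewrite /turns /third0; normalize_turns.
by rewrite !intS; congr translate; ring.
Qed.

(** This value is positive, as is the one for [third2], so these residues of [a + b] admit no
    tiling. *)
Lemma turns_third1 n m : turns (@third1 n m state) =1
  translate 0 0 ((n%:Z + m%:Z + 1) * (n%:Z + m%:Z + 2) + 2 * n%:Z * m%:Z).
Proof.
move=> x; rewrite /turns /third1; normalize_turns.
by rewrite ?intS; congr translate; ring.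
Qed.

Lemma turns_third2 n m : turns (@third2 n m state) =1
  translate 0 0 ((n%:Z - m%:Z) ^+ 2 + (n%:Z + m%:Z + 2)).
Proof.
move=> x; rewrite /turns /third2; normalize_turns.
by rewrite !intS; congr translate; ring.
Qed.

(** The three differences sum to 0 and are at least [1 - a], so none exceeds [2 a - 2]; equality
    would force the other two to coincide, but they differ modulo 3. *)
Lemma in_benzel_degenerate a b p q : 2 * a - 1 <= b ->
  in_benzel a b p q = in_benzel a (2 * a - 2) p q.
Proof. by rewrite /in_benzel => h; lia. Qed.

Lemma in_benzel_degenerate' a b p q : 2 * b - 1 <= a ->
  in_benzel a b p q = in_benzel (2 * b - 2) b p q.
Proof. by rewrite /in_benzel => h; lia. Qed.

Lemma bone_pos_ext S S' tau : (forall p q, S p q = S' p q) ->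
  bone_pos S tau -> bone_pos S' tau.
Proof.
move=> SS' h p q; rewrite -SS' => /h[r3 {}h]; split=> // t /h /=.
by rewrite SS'.
Qed.

Lemma tiling_pentagonal_nondegenerate a b tau :
  2 <= a -> a + 2 <= 2 * b -> 2 <= b -> b + 2 <= 2 * a ->
  bone_pos (in_benzel a b) tau -> a + b = 3 * (a - b) ^+ 2.
Proof.
move=> a2 ab b2 ba htau.
have [hr|[hr|hr]] : (2 * a - b) = 3 * ((2 * a - b) %/ 3)%Z \/
   ((2 * a - b) = 3 * ((2 * a - b) %/ 3)%Z + 2 \/
   (2 * a - b) = 3 * ((2 * a - b) %/ 3)%Z + 1) by lia.
- pose n : nat := (absz ((2 * a - b) %/ 3)%Z).-1.
  pose m : nat := (absz ((2 * b - a) %/ 3)%Z).-1.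
  have ha : a = 2 * n%:Z + 2 + m.+1%:Z by rewrite /n /m; lia.
  have hb : b = n%:Z + 1 + 2 * m.+1%:Z by rewrite /n /m; lia.
  have := tiling_area htau (fun s f0 f1 sK hf => walk_third0 sK hf ha hb) (turns_third0 n m).
  by rewrite ha hb; lia.
- pose n : nat := absz ((2 * a - b) %/ 3)%Z.
  pose m : nat := absz ((2 * b - a) %/ 3)%Z.
  have ha : a = 2 * n%:Z + m%:Z + 2 by rewrite /n /m; lia.
  have hb : b = n%:Z + 2 * m%:Z + 2 by rewrite /n /m; lia.
  have := tiling_area htau (fun s f0 f1 sK hf => walk_third1 sK hf ha hb) (turns_third1 n m).
  by nia.
- pose n : nat := (absz ((2 * a - b) %/ 3)%Z).-1.
  pose m : nat := (absz ((2 * b - a) %/ 3)%Z).-1.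
  have ha : a = 2 * n%:Z + m.+1%:Z + 3 by rewrite /n /m; lia.
  have hb : b = n%:Z + 2 * m.+1%:Z + 2 by rewrite /n /m; lia.
  have := tiling_area htau (fun s f0 f1 sK hf => walk_third2 sK hf ha hb) (turns_third2 n m).
  have := sqr_ge0 (n%:Z - m%:Z); lia.
Qed.

Lemma tiling_pentagonal a b tau :
  2 <= a -> a <= 2 * b -> 2 <= b -> b <= 2 * a ->
  bone_pos (in_benzel a b) tau -> a + b = 3 * (a - b) ^+ 2.
Proof.
move=> a2 ab b2 ba htau.
have [le1|gt1] := lerP (2 * a - 1) b.
  have /tiling_pentagonal_nondegenerate :=
    bone_pos_ext (fun p q => in_benzel_degenerate p q le1) htau.
  (* This equation fails modulo 3, so there is no tiling here. *)
  move=> h; have : a + (2 * a - 2) = 3 * (a - (2 * a - 2)) ^+ 2 by apply: h; lia.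
  by rewrite expr2; nia.
have [le2|gt2] := lerP (2 * b - 1) a.
  have /tiling_pentagonal_nondegenerate :=
    bone_pos_ext (fun p q => in_benzel_degenerate' p q le2) htau.
  move=> h; have : (2 * b - 2) + b = 3 * (2 * b - 2 - b) ^+ 2 by apply: h; lia.
  by rewrite expr2; nia.
by apply: tiling_pentagonal_nondegenerate htau; lia.
Qed.

(** * Convex hulls and affine coordinates *)

Section Plane.
Local Open Scope classical_set_scope.
Context {R : realType}.
Implicit Types (x y : R) (z : R[i]).

Let s : R := sin (2 * pi / 3).

Lemma sin_2pi3_gt0 : 0 < s.
Proof. by apply: sin_gt0_pi; have := @pi_gt0 R; lra. Qed.

(** Expanding the cosine and sine of three times the angle gives a cube root of unity, singled out
    by its positive sine. *)
Lemma trig_2pi3 : cos (2 * pi / 3) = - 1 / 2 :> R /\ s ^+ 2 = 3 / 4.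
Proof.
have s0 := sin_2pi3_gt0.
have : cos (2 * pi / 3 + 2 * pi / 3 + 2 * pi / 3) = 1 :> R.
  by rewrite -[RHS]cos2pi; congr cos; rewrite -mulr_natl; lra.
have : sin (2 * pi / 3 + 2 * pi / 3 + 2 * pi / 3) = 0 :> R.
  by rewrite -[RHS]sin2pi; congr sin; rewrite -mulr_natl; lra.
have := cos2Dsin2 (2 * pi / 3 : R).
rewrite !(sinD, cosD) -/s; move: (cos (2 * pi / 3)) s s0 => c t t0 h1 h2 h3.
have e : c * c = 1 - t * t by move: h1; rewrite !expr2; lra.
have h2' : 3 * t * (c * c) = t * (t * t) by lra.
have h3' : c * (c * c) - 3 * c * (t * t) = 1 by lra.
have t2 : t ^+ 2 = 3 / 4.
  by apply: (mulfI (lt0r_neq0 t0)); rewrite expr2; move: h2'; rewrite e; lra.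
by split=> //; move: h3'; rewrite e -expr2 t2; lra.
Qed.

(** The point [x + y omega]; [xc] and [yc] are the coordinates in the basis [1, omega]. *)
Definition pt x y : R[i] := ((x - y / 2) +i* (s * y))%C.
Definition xc z : R := complex.Re z + complex.Im z / (2 * s).
Definition yc z : R := complex.Im z / s.

Lemma xcK x y : xc (pt x y) = x.
Proof. by rewrite /xc /=; have := sin_2pi3_gt0 => s0; field; exact: lt0r_neq0. Qed.

Lemma ycK x y : yc (pt x y) = y.
Proof. by rewrite /yc /=; have := sin_2pi3_gt0 => s0; field; exact: lt0r_neq0. Qed.

Lemma ptK z : pt (xc z) (yc z) = z.
Proof.
have s0 := sin_2pi3_gt0; case: z => u v; rewrite /pt /xc /yc /=.
by congr Complex; field; exact: lt0r_neq0.
Qed.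

Lemma ptD x y x' y' : pt x y + pt x' y' = pt (x + x') (y + y').
Proof. by rewrite /pt; apply/eqP; rewrite eq_complex /=; apply/andP; split; apply/eqP; field. Qed.

Lemma ptN x y : - pt x y = pt (- x) (- y).
Proof. by rewrite /pt; apply/eqP; rewrite eq_complex /=; apply/andP; split; apply/eqP; field. Qed.

Lemma ptZ c x y : c%:C%C * pt x y = pt (c * x) (c * y).
Proof. by rewrite /pt; apply/eqP; rewrite eq_complex /=; apply/andP; split; apply/eqP; field. Qed.

Lemma one_pt : 1 = pt 1 0.
Proof. by apply/eqP; rewrite eq_complex /=; apply/andP; split; apply/eqP; field. Qed.

Lemma omega_pt : omega = pt 0 1.
Proof.
have [hc _] := trig_2pi3; rewrite /omega hc -/s.
by apply/eqP; rewrite eq_complex /=; apply/andP; split; apply/eqP; field.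
Qed.

Lemma omega2_pt : omega ^+ 2 = pt (-1) (-1).
Proof.
have [_ hs] := trig_2pi3; rewrite omega_pt expr2.
apply/eqP; rewrite eq_complex /=; apply/andP; split; apply/eqP; last by field.
by have : s * s = 3 / 4 by []; lra.
Qed.

Lemma int_pt (n : int) : n%:~R = pt n%:~R 0.
Proof.
rewrite -[LHS](rmorph_int (real_complex R : {rmorphism R -> R[i]})).
by rewrite -[LHS]mulr1 one_pt ptZ mulr1 mulr0.
Qed.

Lemma int_ptM (n : int) x y : n%:~R * pt x y = pt (n%:~R * x) (n%:~R * y).
Proof. by rewrite -[n%:~R in LHS](rmorph_int (real_complex R : {rmorphism R -> R[i]})) ptZ. Qed.

Lemma hull_coord (S : seq R[i]) z : convex_hull S z ->
  exists t : 'I_(size S) -> R, [/\ forall i, 0 <= t i, \sum_i t i = 1,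
    xc z = \sum_i t i * xc S`_i & yc z = \sum_i t i * yc S`_i].
Proof.
case=> t [t0 t1 ->]; exists t; split=> //.
  rewrite (big_morph xc (id1 := 0) (op1 := +%R)) /xc /=; last by rewrite mul0r addr0.
    by apply: eq_bigr => i _; case: (S`_i) => u v /=; rewrite !mul0r subr0 addr0; lra.
  by move=> [u v] [u' v']; rewrite /= mulrDl addrACA.
rewrite (big_morph yc (id1 := 0) (op1 := +%R)) /yc /=; last by rewrite mul0r.
  by apply: eq_bigr => i _; case: (S`_i) => u v /=; rewrite !mul0r addr0 mulrA.
by move=> [u v] [u' v']; rewrite /= mulrDl.
Qed.

Lemma hull_le (S : seq R[i]) (al be M : R) z :
  (forall w, w \in S -> al * xc w + be * yc w <= M) ->
  convex_hull S z -> al * xc z + be * yc z <= M.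
Proof.
move=> h /hull_coord[t [t0 t1 -> ->]].
rewrite !mulr_sumr -big_split /= -[M]mulr1 -t1 mulr_sumr; apply: ler_sum => i _.
by have := h _ (mem_nth 0 (ltn_ord i)); have := t0 i; nra.
Qed.

Lemma hull_mem (S : seq R[i]) z : z \in S -> convex_hull S z.
Proof.
move=> zS; have iS : (index z S < size S)%N by rewrite index_mem.
exists (fun i => (i == Ordinal iS)%:R); split=> [i||]; first exact: ler0n.
  by rewrite (bigD1 (Ordinal iS)) //= eqxx big1 ?addr0 // => i /negbTE ->.
rewrite (bigD1 (Ordinal iS)) //= eqxx big1 => [|i /negbTE ->]; last by rewrite mul0r.
by rewrite addr0 mul1r nth_index.
Qed.

Lemma hull_nth (S : seq R[i]) (k : nat) z :
  (k < size S)%N -> S`_k = z -> convex_hull S z.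
Proof. by move=> kS <-; apply/hull_mem/mem_nth. Qed.

Lemma hull_convex (S : seq R[i]) (t : R) z z' : 0 <= t <= 1 ->
  convex_hull S z -> convex_hull S z' ->
  convex_hull S (t%:C%C * z + (1 - t)%:C%C * z').
Proof.
move=> t01 [u [u0 u1 ->]] [v [v0 v1 ->]].
exists (fun i => t * u i + (1 - t) * v i); split=> [i||].
- by have := u0 i; have := v0 i; nra.
- by rewrite big_split /= -!mulr_sumr u1 v1; ring.
rewrite !mulr_sumr -big_split /=; apply: eq_bigr => i _.
case: (S`_i) => p q; apply/eqP.
by rewrite eq_complex /=; apply/andP; split; apply/eqP; ring.
Qed.

Lemma hull_segment (S : seq R[i]) x1 y1 x2 y2 x y (t : R) : 0 <= t <= 1 ->
  convex_hull S (pt x1 y1) -> convex_hull S (pt x2 y2) ->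
  x = t * x1 + (1 - t) * x2 -> y = t * y1 + (1 - t) * y2 ->
  convex_hull S (pt x y).
Proof. by move=> t01 h1 h2 -> ->; rewrite -ptD -!ptZ; exact: hull_convex. Qed.

(** One form serves both for cells ([a = b = 1]) and for the benzel hexagon (center 0). *)
Definition in_hexagon x0 y0 a b x y :=
  [/\ - a <= x - x0 <= b, - b <= y - y0 <= a & - a <= (y - y0) - (x - x0) <= b].

Lemma hull_hsegment (S : seq R[i]) x1 x2 x y : x1 <= x <= x2 ->
  convex_hull S (pt x1 y) -> convex_hull S (pt x2 y) -> convex_hull S (pt x y).
Proof.
(* A segment reduced to a point is set apart, to avoid a division by 0. *)
move=> /andP[h1 h2] c1 c2; have [e|ne] := eqVneq x1 x2.
  by have -> : x = x1 by lra.
have d : x2 - x1 != 0 by rewrite subr_eq0 eq_sym.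
have d0 : 0 < x2 - x1 by lra.
apply: (@hull_segment _ _ _ _ _ _ _ ((x2 - x) / (x2 - x1)) _ c1 c2); [|by field|by ring].
by rewrite divr_ge0 ?ler_pdivrMr //; lra.
Qed.

Lemma hull_vsegment (S : seq R[i]) x1 y1 y2 c y : y1 <= y <= y2 ->
  convex_hull S (pt x1 y1) -> convex_hull S (pt (x1 + c * (y2 - y1)) y2) ->
  convex_hull S (pt (x1 + c * (y - y1)) y).
Proof.
move=> /andP[h1 h2] c1 c2; have [e|ne] := eqVneq y1 y2.
  by have -> : y = y1; [lra|rewrite subrr mulr0 addr0].
have d : y2 - y1 != 0 by rewrite subr_eq0 eq_sym.
have d0 : 0 < y2 - y1 by lra.
apply: (@hull_segment _ _ _ _ _ _ _ ((y2 - y) / (y2 - y1)) _ c1 c2); [|by field|by field].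
by rewrite divr_ge0 ?ler_pdivrMr //; lra.
Qed.

(** The diagonal [y = y0 + b - a] cuts the hexagon into two trapezoids; a point lies on a horizontal
    segment between their slanted sides. *)
Lemma hull_hexagon (S : seq R[i]) x0 y0 a b x y : a <= 2 * b -> b <= 2 * a ->
  convex_hull S (pt (x0 + b) (y0 + a)) -> convex_hull S (pt (x0 + a - b) (y0 + a)) ->
  convex_hull S (pt (x0 - a) (y0 + b - a)) -> convex_hull S (pt (x0 - a) (y0 - b)) ->
  convex_hull S (pt (x0 + a - b) (y0 - b)) -> convex_hull S (pt (x0 + b) (y0 + b - a)) ->
  in_hexagon x0 y0 a b x y -> convex_hull S (pt x y).
Proof.
move=> ab ba p1 p2 p3 p4 p5 p6 [hx hy hd].
have [le|lt] := lerP (y0 + b - a) y.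
- apply: (@hull_hsegment _ (x0 - a + 1 * (y - (y0 + b - a))) (x0 + b + 0 * (y - (y0 + b - a)))).
  + lra.
  + apply: (@hull_vsegment _ _ _ (y0 + a)); [lra|exact: p3|].
    by rewrite (_ : x0 - a + _ = x0 + a - b); [|ring].
  + apply: (@hull_vsegment _ _ _ (y0 + a)); [lra|exact: p6|].
    by rewrite mul0r addr0.
- apply: (@hull_hsegment _ (x0 - a + 0 * (y - (y0 - b))) (x0 + a - b + 1 * (y - (y0 - b)))).
  + lra.
  + apply: (@hull_vsegment _ _ _ (y0 + b - a)); [lra|exact: p4|].
    by rewrite mul0r addr0.
  + apply: (@hull_vsegment _ _ _ (y0 + b - a)); [lra|exact: p5|].
    by rewrite (_ : x0 + a - b + _ = x0 + b); [|ring].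
Qed.

Lemma hull_in_hexagon (S : seq R[i]) x0 y0 a b z :
  (forall w, w \in S -> in_hexagon x0 y0 a b (xc w) (yc w)) ->
  convex_hull S z -> in_hexagon x0 y0 a b (xc z) (yc z).
Proof.
move=> h hz.
have bound al be M : (forall w, w \in S -> al * xc w + be * yc w <= M) ->
    al * xc z + be * yc z <= M by move=> ?; exact: hull_le hz.
have h1 : 1 * xc z + 0 * yc z <= x0 + b by apply: bound => w /h[]; lra.
have h2 : -1 * xc z + 0 * yc z <= a - x0 by apply: bound => w /h[]; lra.
have h3 : 0 * xc z + 1 * yc z <= y0 + a by apply: bound => w /h[]; lra.
have h4 : 0 * xc z + -1 * yc z <= b - y0 by apply: bound => w /h[]; lra.
have h5 : -1 * xc z + 1 * yc z <= b + y0 - x0 by apply: bound => w /h[]; lra.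
have h6 : 1 * xc z + -1 * yc z <= a - y0 + x0 by apply: bound => w /h[]; lra.
by split; lra.
Qed.

Lemma cellP x0 y0 z : cell (pt x0 y0) z <-> in_hexagon x0 y0 1 1 (xc z) (yc z).
Proof.
rewrite /cell omega2_pt omega_pt one_pt !ptN !ptD; split.
  apply: hull_in_hexagon => w; rewrite !inE.
  by do 5?[case/orP]; move/eqP=> ->; rewrite xcK ycK; split; lra.
rewrite -[X in convex_hull _ X](ptK z); apply: hull_hexagon; [lra|lra|..];
  [ apply: (@hull_nth _ 5) | apply: (@hull_nth _ 2) | apply: (@hull_nth _ 1)
  | apply: (@hull_nth _ 4) | apply: (@hull_nth _ 3) | apply: (@hull_nth _ 0)];
  by rewrite //=; congr pt; ring.
Qed.

Lemma benzel_hexagonP (a b : int) z : a <= 2 * b -> b <= 2 * a ->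
  benzel_hexagon a b z <-> in_hexagon 0 0 a%:~R b%:~R (xc z) (yc z).
Proof.
move=> ab ba.
have {}ab : a%:~R <= 2 * b%:~R :> R by have := ab; rewrite -(ler_int R) intrM.
have {}ba : b%:~R <= 2 * a%:~R :> R by have := ba; rewrite -(ler_int R) intrM.
rewrite /benzel_hexagon omega2_pt omega_pt !mulNr !int_ptM !int_pt !ptN !ptD. split.
  apply: hull_in_hexagon => w; rewrite !inE.
  by do 5?[case/orP]; move/eqP=> ->; rewrite xcK ycK; split; lra.
rewrite -[X in convex_hull _ X](ptK z); apply: hull_hexagon => //;
  [ apply: (@hull_nth _ 0) | apply: (@hull_nth _ 1) | apply: (@hull_nth _ 2)
  | apply: (@hull_nth _ 3) | apply: (@hull_nth _ 4) | apply: (@hull_nth _ 5)];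
  by rewrite //=; congr pt; ring.
Qed.

Definition cell_center (p q : int) : R[i] := pt (2 * p + q - 1)%:~R (p - q)%:~R.

Lemma Lm1P z : Lm1 z <-> exists p q, z = cell_center p q.
Proof.
split=> [[x [y [h ->]]]|[p [q ->]]].
  exists ((x + y + 1) %/ 3)%Z, (((x + y + 1) %/ 3)%Z - y).
  rewrite omega_pt int_ptM int_pt ptD mulr0 mulr1 addr0 add0r /cell_center.
  by congr (pt _%:~R _%:~R); lia.
exists (2 * p + q - 1), (p - q); split; first by lia.
by rewrite omega_pt int_ptM int_pt ptD mulr0 mulr1 addr0 add0r.
Qed.

Lemma cell_sub_hexagon (a b p q : int) : a <= 2 * b -> b <= 2 * a ->
  cell (cell_center p q) `<=` benzel_hexagon a b <-> in_benzel a b p q.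
Proof.
move=> ab ba; split=> [h|].
  have corner (x y : int) :
      in_hexagon (2 * p + q - 1)%:~R (p - q)%:~R 1 1 (x%:~R : R) y%:~R ->
      [/\ - a <= x <= b, - b <= y <= a & - a <= y - x <= b].
    move=> hc; have : benzel_hexagon a b (pt x%:~R y%:~R : R[i]).
      by apply: h; apply/cellP; rewrite xcK ycK.
    move/(benzel_hexagonP _ ab ba); rewrite xcK ycK /in_hexagon !subr0.
    by rewrite -!(intrN, intrB) !ler_int.
  have c (x y : int) : - 1 <= x - (2 * p + q - 1) <= 1 -> - 1 <= y - (p - q) <= 1 ->
     - 1 <= y - (p - q) - (x - (2 * p + q - 1)) <= 1 ->
     [/\ - a <= x <= b, - b <= y <= a & - a <= y - x <= b].
    move=> h1 h2 h3; apply: corner; rewrite /in_hexagon.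
    by rewrite -!intrB; split; [move: h1|move: h2|move: h3];
      rewrite -!(ler_int R) intrN.
  (* The four corners [alpha + 1], [alpha - 1], [alpha + omega], [alpha - omega] yield all six
     bounds. *)
  have [] := c (2 * p + q) (p - q); [lia..|].
  have [] := c (2 * p + q - 2) (p - q); [lia..|].
  have [] := c (2 * p + q - 1) (p - q + 1); [lia..|].
  have [] := c (2 * p + q - 1) (p - q - 1); [lia..|].
  rewrite /in_benzel; lia.
move=> hB z /cellP hz; apply/(benzel_hexagonP _ ab ba).
have [h1 [h2 [h3 [h4 [h5 h6]]]]] : 1 - a <= 2 * p + q - 1 /\ 2 * p + q - 1 <= b - 1 /\
   1 - b <= p - q /\ p - q <= a - 1 /\ 1 - a <= (p - q) - (2 * p + q - 1) /\
   (p - q) - (2 * p + q - 1) <= b - 1 by move: hB; rewrite /in_benzel; lia.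
move: h1 h2 h3 h4 h5 h6 hz; rewrite -!(ler_int R) !intrB.
by move: (2 * p + q)%:~R p%:~R q%:~R => X P Q h1 h2 h3 h4 h5 h6 []; split; lra.
Qed.

End Plane.

(** * Cells, bones and interiors *)

Section Bridge.
Local Open Scope classical_set_scope.
Context {R : realType}.
Implicit Types (x y : R) (z : R[i]).

Lemma norm_pt_lt x y (e : R) : 0 < e ->
  (`|pt x y| < e%:C%C) = (x ^+ 2 - x * y + y ^+ 2 < e ^+ 2).
Proof.
move=> e0; rewrite normc_def ltcR -[e in LHS]ger0_norm ?ltW // -sqrtr_sqr.
rewrite ltr_sqrt ?exprn_gt0 //=; congr (_ < _).
have [_ hs] := @trig_2pi3 R; by rewrite exprMn hs; field.
Qed.

(** The disc of radius 1/2 about the center lies in the cell: [u^2 - u v + v^2] is at least 3/4 of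
    each of [u^2], [v^2] and [(u - v)^2]. *)
Lemma interior_cell (p q : int) (A : set R[i]) :
  cell (cell_center p q) `<=` A -> plane_interior A (cell_center p q).
Proof.
move=> hA; apply/nbhs_ballP; exists ((1 / 2 : R)%:C%C) => /=; first by rewrite ltcR; lra.
move=> w; rewrite -ball_normE /= => hw; apply: hA.
move: hw; rewrite -[w]ptK /cell_center ptN ptD norm_pt_lt; last by lra.
move: (2 * p + q - 1)%:~R (p - q)%:~R => x0 y0 h; apply/cellP; rewrite xcK ycK.
move: h; rewrite /in_hexagon.
have -> : yc w - y0 - (xc w - x0) = (x0 - xc w) - (y0 - yc w) by ring.
rewrite -(opprB x0) -(opprB y0) !expr2; move: (x0 - _) (y0 - _) => u v h.
have := sqr_ge0 (v - u / 2); have := sqr_ge0 (u - v / 2); have := sqr_ge0 (u + v).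
by rewrite !expr2 => *; split; nra.
Qed.

Lemma interior_shrink (A : set R[i]) x y x' y' : plane_interior A (pt x y) ->
  exists t : R, 0 < t < 1 /\ A (pt (x + t * (x' - x)) (y + t * (y' - y))).
Proof.
move=> /nbhs_ballP[e /= e0 h].
have [r re] : exists r : R, e = r%:C%C.
  by exists (complex.Re e); rewrite RRe_real // realE ltW.
have r0 : 0 < r by rewrite -ltcR -re.
pose u := x' - x; pose v := y' - y.
have Q0 : 0 <= u ^+ 2 - u * v + v ^+ 2 by nra.
pose D := r + (u ^+ 2 - u * v + v ^+ 2) + 1.
have D0 : 0 < D by rewrite /D; lra.
exists (r / D); split; first by rewrite divr_gt0 // ltr_pdivrMr // /D; lra.
apply: h; rewrite -ball_normE /= ptN ptD re norm_pt_lt //.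
set t := r / D; rewrite -/u -/v.
have -> : (x - (x + t * u)) ^+ 2 - (x - (x + t * u)) * (y - (y + t * v)) +
    (y - (y + t * v)) ^+ 2 = t ^+ 2 * (u ^+ 2 - u * v + v ^+ 2) by ring.
rewrite /t expr_div_n mulrAC ltr_pdivrMr ?exprn_gt0 //.
rewrite ltr_pM2l ?exprn_gt0 //; rewrite /D; nra.
Qed.

Definition step (d : dir) : R[i] := pt (2 * vx d + vy d)%:~R (vx d - vy d)%:~R.
Definition bone_at (d : dir) (p q : int) : set R[i] := bone (cell_center p q) (step d).

Lemma center_step d (p q : int) (n : int) :
  cell_center p q + n%:~R * step d = cell_center (p + n * vx d) (q + n * vy d).
Proof.
by rewrite /cell_center /step int_ptM ptD -!intrM -!intrD; congr (pt _%:~R _%:~R); ring.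
Qed.

Lemma bone_atP d p q z : bone_at d p q z <->
  exists2 t : nat, (t < 3)%N & cell (cell_center (p + t%:Z * vx d) (q + t%:Z * vy d)) z.
Proof.
rewrite /bone_at /bone.
have -> : cell_center p q + step d = cell_center (p + 1%:Z * vx d) (q + 1%:Z * vy d).
  by rewrite -center_step mul1r.
have -> : cell_center p q + 2 * step d = cell_center (p + 2%:Z * vx d) (q + 2%:Z * vy d).
  by rewrite -center_step.
split=> [[[h|h]|h]|[[|[|[|]]] // _ h]].
- by exists 0%N => //; rewrite !mul0r !addr0.
- by exists 1%N.
- by exists 2%N.
- by left; left; move: h; rewrite !mul0r !addr0.
- by left; right.
- by right.
Qed.

Lemma bone_opp (alpha d : R[i]) : bone alpha (- d) = bone (alpha - 2 * d) d.
Proof.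
rewrite /bone.
have -> : alpha + 2 * - d = alpha - 2 * d by ring.
have -> : alpha - 2 * d + d = alpha - d by ring.
have -> : alpha - 2 * d + 2 * d = alpha by ring.
by rewrite setUC (setUC (cell alpha)) setUA.
Qed.

Lemma step_dirs : [/\ step D1 = 1 - omega, step D2 = - (omega ^+ 2 - 1)
  & step D3 = omega - omega ^+ 2].
Proof.
rewrite omega2_pt omega_pt one_pt /step !ptN !ptD ?ptN /=.
by split; congr pt; ring.
Qed.

Lemma is_boneP (B : set R[i]) : is_bone B <-> exists d p q, B = bone_at d p q.
Proof.
have [e1 e2 e3] := step_dirs.
split=> [[alpha [v [/Lm1P[p [q ->]] hv ->]]]|[d [p [q ->]]]].
  have [d [->|->]] : exists d, v = step d \/ v = - step d.
    move: hv; rewrite !inE -e1 -e3 -[omega ^+ 2 - 1]opprK -e2 opprK.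
    by do 5?[case/orP]; move/eqP=> ->;
      [exists D1; left|exists D1; right|exists D3; left|exists D3; right
      |exists D2; right|exists D2; left].
  by exists d, p, q.
  rewrite bone_opp; exists d, (p - 2 * vx d), (q - 2 * vy d).
  rewrite /bone_at; congr bone.
  by have := center_step d p q (-2); rewrite intrN mulNr => ->; congr cell_center; ring.
exists (cell_center p q), (step d); split=> //; first by apply/Lm1P; exists p, q.
by rewrite !inE; case: d; rewrite ?e1 ?e2 ?e3 eqxx ?orbT.
Qed.

(** A point strictly inside a cell is in no other: the center coordinates, and their difference,
    would each differ by at most 1, while the sum of the first two differences is a multiple of
    3. *)
Lemma center_cell_inj (p q p' q' : int) (x y : R) :
  `|x - (2 * p + q - 1)%:~R| < 1 -> `|y - (p - q)%:~R| < 1 ->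
  `|(y - (p - q)%:~R) - (x - (2 * p + q - 1)%:~R)| < 1 ->
  cell (cell_center p' q') (pt x y) -> p = p' /\ q = q'.
Proof.
rewrite !ltr_norml => h1 h2 h3 /cellP; rewrite xcK ycK => -[h4 h5 h6].
have [k1 k2 k3] : [/\ -2 < (2 * p + q - 1) - (2 * p' + q' - 1) < 2,
    -2 < (p - q) - (p' - q') < 2 &
    -2 < ((p - q) - (p' - q')) - ((2 * p + q - 1) - (2 * p' + q' - 1)) < 2].
  rewrite -!(ltr_int R) !intrB !intrN; move: h1 h2 h3 h4 h5 h6; rewrite !intrB.
  by move=> *; split; lra.
clear - k1 k2 k3; lia.
Qed.

Lemma center_in_cell (p q p' q' : int) :
  cell (cell_center p' q') (cell_center p q : R[i]) -> p = p' /\ q = q'.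
Proof. by apply: center_cell_inj; rewrite !subrr ?subrr normr0 ltr01. Qed.

Lemma center_cell (p q : int) : cell (cell_center p q) (cell_center p q : R[i]).
Proof. by apply/cellP; rewrite xcK ycK /in_hexagon !subrr; split; lra. Qed.
End Bridge.

(** * Geometric and combinatorial tilings *)

Section Tileable.
Local Open Scope classical_set_scope.
Context {R : realType}.

(** The only cell centers in a bone are those of its own cells. *)
Lemma bone_at_inj d p q d' p' q' :
  bone_at d p q = bone_at d' p' q' :> set R[i] -> [/\ d = d', p = p' & q = q'].
Proof.
move=> E.
have h (t : nat) : (t < 3)%N -> exists2 k : nat, (k < 3)%N &
    p + t%:Z * vx d = p' + k%:Z * vx d' /\ q + t%:Z * vy d = q' + k%:Z * vy d'.
  move=> t3; have /bone_atP[k k3 /center_in_cell ?] :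
      bone_at d' p' q' (cell_center (p + t%:Z * vx d) (q + t%:Z * vy d) : R[i]).
    by rewrite -E; apply/bone_atP; exists t => //; exact: center_cell.
  by exists k.
have [k0 k03 [e0 f0]] := h 0%N isT; have [k1 k13 [e1 f1]] := h 1%N isT.
have [k2 k23 [e2 f2]] := h 2%N isT; move: e0 f0 e1 f1 e2 f2 {E h}.
by case: d d' => [] [] /= *; split => //; lia.
Qed.

Lemma tileable_bone_pos (a b : int) : a <= 2 * b -> b <= 2 * a ->
  bone_tileable (benzel a b : set R[i]) <-> exists tau, bone_pos (in_benzel a b) tau.
Proof.
move=> ab ba.
have benzel_cell p q :
    cell (cell_center p q) `<=` (benzel a b : set R[i]) <-> in_benzel a b p q.
  split=> h.
    apply/(cell_sub_hexagon (R := R) _ _ ab ba) => z /h[al [_ hal]]; exact: hal.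
  move=> z hz; exists (cell_center p q) => //; split; first by apply/Lm1P; exists p, q.
  exact/(cell_sub_hexagon _ _ ab ba).
split=> [[T [Tbone Ttriv Tcov]]|[tau htau]].
  have TB B : T B -> B `<=` (benzel a b : set R[i]).
    by move=> TB z Bz; rewrite -Tcov; exists B.
  (* A tile covering the center of a cell must contain that cell. *)
  have /choice[tau htau] : forall c : int * int, exists x : dir * nat,
      in_benzel a b c.1 c.2 -> (x.2 < 3)%N /\
      T (bone_at x.1 (c.1 - x.2%:Z * vx x.1) (c.2 - x.2%:Z * vy x.1)).
    move=> [p q] /=; case: (boolP (in_benzel a b p q)) => [hB|_]; last by exists (D1, 0%N).
    have : (benzel a b : set R[i]) (cell_center p q).
      exact: (benzel_cell p q).2 hB _ (center_cell p q).
    rewrite -Tcov => -[B TB' Bc]; have [d [p' [q' e]]] := (is_boneP B).1 (Tbone _ TB').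
    move: Bc; rewrite e => /bone_atP[t t3 /center_in_cell[-> ->]].
    by exists (d, t) => _; rewrite /= !addrK -e.
  exists (fun p q => tau (p, q)) => p q /(htau (p, q)) /=.
  case: (tau (p, q)) => d r /= [r3 TB0]; split=> // t t3.
  set p' := p + _; set q' := q + _.
  have hsub : cell (cell_center p' q') `<=`
      (bone_at d (p - r%:Z * vx d) (q - r%:Z * vy d) : set R[i]).
    have ep : p - r%:Z * vx d + t%:Z * vx d = p' by rewrite /p'; ring.
    have eq : q - r%:Z * vy d + t%:Z * vy d = q' by rewrite /q'; ring.
    by move=> z hz; apply/bone_atP; exists t => //; rewrite ep eq.
  have hB' : in_benzel a b p' q' by apply/benzel_cell; apply: subset_trans hsub (TB _ TB0).
  split=> //; have := htau (p', q') hB'; rewrite /=.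
  case: (tau (p', q')) => d' r' /= [r'3 TB1].
  have hsub' : cell (cell_center p' q') `<=`
      (bone_at d' (p' - r'%:Z * vx d') (q' - r'%:Z * vy d') : set R[i]).
    by move=> z hz; apply/bone_atP; exists r' => //; rewrite !subrK.
  (* Both tiles have the center of this cell in their interior, so they coincide. *)
  have /bone_at_inj[dd' ep eq] := Ttriv _ _ TB0 TB1
    (ex_intro _ (cell_center p' q') (conj (interior_cell hsub) (interior_cell hsub'))).
  subst d'; congr (_, _); move: ep eq; rewrite /p' /q'.
  by case: (d) => /= *; lia.
have bone_sub p q : in_benzel a b p q -> (tau p q).2 = 0%N ->
    forall t : nat, (t < 3)%N -> let p' := p + t%:Z * vx (tau p q).1 in
      let q' := q + t%:Z * vy (tau p q).1 in
      in_benzel a b p' q' /\ tau p' q' = ((tau p q).1, t).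
  by move=> /htau[_ h] r0 t /h; rewrite r0 subr0.
exists [set B | exists p q, [/\ in_benzel a b p q, (tau p q).2 = 0%N
  & B = bone_at (tau p q).1 p q]]; split.
- by move=> B [p [q [_ _ ->]]]; apply/is_boneP; exists (tau p q).1, p, q.
- move=> B B' [p [q [hB r0 ->]]] [p' [q' [hB' r0' ->]]] [z [hz hz']].
  have /bone_atP[t t3] := interior_subset hz.
  set c1 := p + _; set c2 := q + _ => cz.
  (* Moving [z] slightly towards the center of its cell stays in the second bone and enters the open
     cell, which is thus a cell of both bones. *)
  move: hz'; rewrite -[z]ptK => /(interior_shrink (2 * c1 + c2 - 1)%:~R (c1 - c2)%:~R).
  case=> s [s01 /bone_atP[t' t'3 cz']].
  have [E1 E2] : c1 = p' + t'%:Z * vx (tau p' q').1 /\ c2 = q' + t'%:Z * vy (tau p' q').1.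
    move: cz cz'; rewrite -[z]ptK => /cellP; rewrite xcK ycK => -[h1 h2 h3].
    by apply: center_cell_inj; rewrite ltr_norml; nra.
  have [_ e1] := bone_sub _ _ hB r0 t t3; have [_ e2] := bone_sub _ _ hB' r0' t' t'3.
  move: e1 e2; rewrite -/c1 -/c2 -E1 -E2 => -> [ed et].
  move: E1 E2; rewrite /c1 /c2 ed et => /addIr -> /addIr ->.
  by [].
rewrite eqEsubset; split=> z.
  move=> [B [p [q [hB r0 ->]]] /bone_atP[t t3 hz]].
  by have [/benzel_cell h _] := bone_sub _ _ hB r0 t t3; apply: h.
move=> [al [/Lm1P[p [q ->]] hal] hz].
have /htau[r3 h] : in_benzel a b p q by apply/(cell_sub_hexagon (R := R) _ _ ab ba).
have := h 0%N isT; rewrite /= sub0r; set p' := p + _; set q' := q + _ => -[hB' e].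
exists (bone_at (tau p q).1 p' q'); first by exists p', q'; rewrite e.
apply/bone_atP; exists (tau p q).2 => //.
by rewrite /p' /q' !mulNr !subrK.
Qed.
End Tileable.

(** * Pentagonal numbers and conclusion *)

Lemma pentagonal_eq (a b : int) : 2 <= a -> 2 <= b ->
  a + b = 3 * (a - b) ^+ 2 <->
  exists k : int, 2 <= k /\
    ((a = (k * (3 * k - 1) %/ 2)%Z /\ b = (k * (3 * k + 1) %/ 2)%Z) \/
     (a = (k * (3 * k + 1) %/ 2)%Z /\ b = (k * (3 * k - 1) %/ 2)%Z)).
Proof.
move=> a2 b2; rewrite expr2; split=> [h|[k [k2 h]]].
  (* With [k] the absolute difference, the sum is [3 k^2] and the difference [k]. *)
  have [ab|ba] := lerP a b.
    by exists (b - a); split; [nia|left; split; lia].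
  by exists (a - b); split; [nia|right; split; lia].
(* The parity of [k] resolves the divisions by 2. *)
have [j [kj|kj]] : exists j, k = 2 * j \/ k = 2 * j + 1 by exists (k %/ 2)%Z; lia.
  have e1 : (k * (3 * k - 1) %/ 2)%Z = j * (6 * j - 1) by rewrite kj; lia.
  have e2 : (k * (3 * k + 1) %/ 2)%Z = j * (6 * j + 1) by rewrite kj; lia.
  by move: h; rewrite e1 e2 => -[] [-> ->]; ring.
have e1 : (k * (3 * k - 1) %/ 2)%Z = (2 * j + 1) * (3 * j + 1) by rewrite kj; lia.
have e2 : (k * (3 * k + 1) %/ 2)%Z = (2 * j + 1) * (3 * j + 2) by rewrite kj; lia.
by move: h; rewrite e1 e2 => -[] [-> ->]; ring.
Qed.

Lemma pentagonal_bone_pos (a b : int) : 2 <= a -> a <= b ->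
  a + b = 3 * (a - b) ^+ 2 -> exists tau, bone_pos (in_benzel a b) tau.
Proof.
rewrite expr2 => a2 ab h; pose k := absz (b - a)%R.
have k2 : (1 < k)%N by rewrite /k; nia.
have := tri_double k.-1 => htri.
have kE : k%:Z = b - a by rewrite /k; lia.
have k1 : k.-1%:Z = k%:Z - 1 by lia.
have ha : a = 3 * tri k.-1 + k%:Z by move: htri; rewrite k1 kE; lia.
exists (pentagonal_pos k); apply: bone_pos_pentagonal k2 ha _; lia.
Qed.

Theorem theorem3 (R : realType) (a b : int)
    (ha2 : 2 <= a) (ha : a <= 2 * b) (hb2 : 2 <= b) (hb : b <= 2 * a) :
  bone_tileable (benzel a b : set R[i]) <->
  exists k : int, 2 <= k /\
    ((a = (k * (3 * k - 1) %/ 2)%Z /\ b = (k * (3 * k + 1) %/ 2)%Z) \/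
     (a = (k * (3 * k + 1) %/ 2)%Z /\ b = (k * (3 * k - 1) %/ 2)%Z)).
Proof.
apply: (iff_trans (tileable_bone_pos ha hb)).
apply: iff_trans (pentagonal_eq ha2 hb2); split=> [[tau htau]|]; first exact: tiling_pentagonal htau.
move=> h; have [ab|/ltW ba] := lerP a b; first exact: pentagonal_bone_pos.
have [|tau /bone_pos_swap //] := pentagonal_bone_pos hb2 ba.
by rewrite addrC h -[a - b]opprB sqrrN.
Qed.
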